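(* Let $\kappa>0$. In the adversarial arrival model there exists a delayed algorithm whose competitive ratio is at least $\max\left\{\frac{1}{1+\kappa},\frac{\kappa}{1+\kappa}\right\}$ on the family of $\kappa$-undersupplied instances, and likewise on the family of $\kappa$-oversupplied instances. That is, for the relevant family $\mathcal F$, $\inf_{\mathcal I\in\mathcal F}\inf_{\sigma}\mathbb E[\mathrm{ALG}(\mathcal I,\sigma)]/\mathrm{OFF\text{-}I}(\mathcal I)\ge \max\left\{\frac{1}{1+\kappa},\frac{\kappa}{1+\kappa}\right\}$.
   Context: Adversarial online matching with stochastic rewards. An instance $\mathcal I$ consists of a finite set $S$ of supply nodes, a number $T$ of demand nodes indexed by $t\in[T]=\{1,\dots,T\}$, an edge set $E\subseteq S\times[T]$ such that every $t$ has at least one neighbor, and a consumption probability $\mu\in(0,1]$ common to all edges. Let $N(t)=\{u\in S:(u,t)\in E\}$. Demand nodes arrive one per period in an order $\sigma$ chosen by an adversary (w.l.o.g. indexed $1,\dots,T$); on arrival of $t$ the algorithm sees $N(t)$ and must irrevocably match $t$ to some $u\in N(t)$ or leave it unmatched. If $t$ is matched to $u$, then independently with probability $\mu$ the node $t$ chooses to consume $u$; the match is successful (u is consumed) if $t$ chooses to consume $u$ and $u$ has not been consumed before. The value of an algorithm is the number of consumed supply nodes; $\mathbb E[\mathrm{ALG}(\mathcal I,\sigma)]$ denotes its expectation over the algorithm's randomness and the consumption outcomes. A delayed algorithm is a possibly randomized algorithm whose decision in period $t$ may depend on its random seed, the arrivals up to $t$ and its own previous matching decisions, but not on the realized consumption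 outcomes. For $\kappa>0$, $\mathrm{OFF\text{-}I}(\mathcal I,\kappa)$ is the optimal value of the LP: maximize $\sum_{(u,t)\in E}\mu x_{u,t}$ subject to $\sum_{t:(u,t)\in E}\mu x_{u,t}\le\kappa$ for all $u\in S$, $\sum_{u:(u,t)\in E}x_{u,t}\le1$ for all $t\in[T]$, $x\ge0$; and $\mathrm{OFF\text{-}I}(\mathcal I)=\mathrm{OFF\text{-}I}(\mathcal I,1)$. An instance is $\kappa$-undersupplied if $\kappa=\max\{\bar\kappa\ge1:\mathrm{OFF\text{-}I}(\mathcal I,\bar\kappa)=\bar\kappa\,\mathrm{OFF\text{-}I}(\mathcal I)\}$ and $\kappa$-oversupplied if $\kappa=\min\{\bar\kappa\le1:\mathrm{OFF\text{-}I}(\mathcal I,\bar\kappa)=\mathrm{OFF\text{-}I}(\mathcal I)\}$; it is assumed these extrema are attained at rational numbers. An algorithm is $\Gamma$-competitive on a family $\mathcal F$ if $\inf_{\mathcal I\in\mathcal F}\inf_\sigma\mathbb E[\mathrm{ALG}(\mathcal I,\sigma)]/\mathrm{OFF\text{-}I}(\mathcal I)\ge\Gamma$. *)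

(* Defs.v *)
From mathcomp Require Import all_boot all_order all_algebra.
From mathcomp Require Import perm.
From mathcomp Require Import all_classical all_reals all_analysis.

Set Implicit Arguments.
Unset Strict Implicit.
Unset Printing Implicit Defensive.

Import Order.TTheory GRing.Theory Num.Theory.

Local Open Scope classical_set_scope.
Local Open Scope ring_scope.

Record instance (R : realType) := Instance {
  supply : finType;
  horizon : nat;
  edges : {set supply * 'I_horizon};
  mu : R;
  mu_gt0 : 0 < mu;
  mu_le1 : mu <= 1;
  has_neighbor : forall t : 'I_horizon, exists u : supply, (u, t) \in edges }.

Definition neighbors (R : realType) (I : instance R) (t : 'I_(horizon I)) :
  {set supply I} := [set u | (u, t) \in edges I]%SET.

Section LP.
Variables (R : realType) (I : instance R).

Definition off_feasible (k : R) (x : supply I -> 'I_(horizon I) -> R) : Prop :=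
  [/\ forall u, \sum_(t | (u, t) \in edges I) mu I * x u t <= k,
      forall t, \sum_(u | (u, t) \in edges I) x u t <= 1
    & forall u t, (u, t) \in edges I -> 0 <= x u t].

Definition off_objective (x : supply I -> 'I_(horizon I) -> R) : R :=
  \sum_(e in edges I) mu I * x e.1 e.2.

Definition OFF_I (k : R) : R := sup [set off_objective x | x in off_feasible k].

Definition undersupply_factors : set R :=
  [set k | 1 <= k /\ OFF_I k = k * OFF_I 1].

Definition oversupply_factors : set R :=
  [set k | 0 < k <= 1 /\ OFF_I k = OFF_I 1].

Definition is_max (A : set R) (k : R) : Prop := A k /\ ubound A k.
Definition is_min (A : set R) (k : R) : Prop := A k /\ lbound A k.

(* Standing assumption on instances: both extrema are attained, at rationals. *)
Definition rational_extrema : Prop :=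
  (exists q : rat, is_max undersupply_factors (ratr q)) /\
  (exists q : rat, is_min oversupply_factors (ratr q)).

End LP.

Definition undersupplied (R : realType) (k : R) (I : instance R) : Prop :=
  rational_extrema I /\ is_max (undersupply_factors I) k.

Definition oversupplied (R : realType) (k : R) (I : instance R) : Prop :=
  rational_extrema I /\ is_min (oversupply_factors I) k.

(* [decide S w past N prev] is the decision of the current period: [w] is the
   random seed, [past] lists the neighborhoods of the earlier arrivals and
   [prev] the decisions taken for them, both in chronological order, and [N] is
   the neighborhood of the current arrival.  Neither the number of arrivals nor
   any consumption outcome is available. *)
Record delayed_algorithm (R : realType) := DelayedAlgorithm {
  seed_display : measure_display;
  seed : measurableType seed_display;
  seed_law : probability seed R;
  decide : forall S : finType,
    seed -> seq {set S} -> {set S} -> seq (option S) -> option S;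
  decide_neighbor : forall (S : finType) w past N prev (u : S),
    decide w past N prev = Some u -> u \in N;
  decide_measurable : forall (S : finType) past N prev (o : option S),
    measurable [set w | decide w past N prev = o] }.

Section Run.
Variables (R : realType) (A : delayed_algorithm R).

(* Decisions of the first [n] periods on the arrival sequence [a]. *)
Fixpoint decisions (S : finType) (w : seed A) (a : seq {set S}) (n : nat) :
    seq (option S) :=
  if n is n'.+1 then
    let prev := decisions w a n' in
    rcons prev (decide w (take n' a) (nth finset.set0 a n') prev)
  else [::].

(* A period is a decision together with the arrival's choice to consume. *)
Definition consume (S : finType) (C : {set S}) (p : option S * bool) : {set S} :=
  if p.1 is Some u then
    if p.2 && (u \notin C) then (u |: C)%SET else C
  else C.

Definition consumed (S : finType) (d : seq (option S)) (c : seq bool) : {set S} :=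
  foldl (@consume S) finset.set0 (zip d c).

Definition arrivals (I : instance R) (sigma : {perm 'I_(horizon I)}) :
    seq {set supply I} :=
  [seq neighbors (sigma t) | t <- enum 'I_(horizon I)].

(* Expectation over the independent Bernoulli consumption choices [c], for a
   fixed seed. *)
Definition value_given_seed (I : instance R) (sigma : {perm 'I_(horizon I)})
    (w : seed A) : R :=
  \sum_(c : (horizon I).-tuple bool)
    (\prod_(b <- c) (if b then mu I else 1 - mu I)) *
    #|consumed (decisions w (arrivals sigma) (horizon I)) c|%:R.

Definition expected_value (I : instance R) (sigma : {perm 'I_(horizon I)}) :
    \bar R :=
  ('E_(seed_law A)[value_given_seed sigma])%E.

Definition instance_ratio (I : instance R) : \bar R :=
  ereal_inf [set (expected_value sigma / (OFF_I I 1)%:E)%E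
            | sigma in [set: {perm 'I_(horizon I)}]].

(* Valued in [\bar R] so that the infimum over an empty family is [+oo].
   [set (instance R)] would be a universe inconsistency, hence a predicate. *)
Definition competitive_ratio (F : instance R -> Prop) : \bar R :=
  ereal_inf [set r | exists2 I : instance R, F I & r = instance_ratio I].

End Run.

(* Main.v *)
(* The greedy delayed algorithm matches each arrival to a neighbor that was
   matched least often so far.  A node matched [n] times is consumed with
   probability [1 - (1 - mu) ^+ n], so this choice maximizes the expected
   marginal gain, and it does so without knowing [mu].  Price each supply node
   at its final consumption probability and each arrival at its marginal gain.
   These prices are dual feasible for the LP at every capacity [k], and both
   families add up to the value of the algorithm; weak duality gives
   [OFF_I k <= (1 + k) * ALG].  At [k = kappa] the left-hand side is
   [kappa * OFF_I 1] for undersupplied and [OFF_I 1] for oversupplied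
   instances. *)
Require Import Defs.
From mathcomp Require Import all_boot all_order all_algebra.
From mathcomp Require Import perm ring lra.
From mathcomp Require Import all_classical all_reals all_analysis.

Set Implicit Arguments.
Unset Strict Implicit.
Unset Printing Implicit Defensive.

Import Order.TTheory GRing.Theory Num.Theory.

Local Open Scope ring_scope.

(** * Weak duality and scaling for the offline LP *)

Section LinearProgram.
Variables (R : realType) (I : instance R).
Implicit Types (k : R) (x : supply I -> 'I_(horizon I) -> R).

Lemma off_objectiveE x :
  off_objective x = \sum_u \sum_(t | (u, t) \in edges I) mu I * x u t.
Proof.
rewrite pair_big_dep /off_objective /=.
by apply: eq_bigl => -[u t].
Qed.

Lemma off_feasible0 k : 0 <= k -> off_feasible k (fun (_ : supply I) _ => 0).
Proof.
move=> k0; split=> // [u|t]; rewrite big1 // => *; exact: mulr0.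
Qed.

Lemma off_objectives_neq0 k : 0 <= k ->
  ([set off_objective x | x in @off_feasible R I k] !=set0)%classic.
Proof.
by move=> k0; eexists; exists (fun _ _ => 0) => //; exact: off_feasible0.
Qed.

Lemma off_weak_duality k (alpha : supply I -> R)
    (beta : 'I_(horizon I) -> R) x :
    (forall u, 0 <= alpha u) -> (forall t, 0 <= beta t) ->
    (forall u t, (u, t) \in edges I -> mu I <= mu I * alpha u + beta t) ->
    off_feasible k x ->
  off_objective x <= k * \sum_u alpha u + \sum_t beta t.
Proof.
move=> alpha0 beta0 dual_feasible [capacity demand x0].
have -> : k * \sum_u alpha u = \sum_u alpha u * k.
  by rewrite mulrC mulr_suml.
(* Each edge's coefficient [mu I] is replaced by its dual price; the [alpha] part is then bounded
   through the capacities and the [beta] part through the demands. *)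
apply: (@le_trans _ _
  (\sum_u \sum_(t | (u, t) \in edges I) (mu I * alpha u + beta t) * x u t)).
  rewrite off_objectiveE; apply: ler_sum => u _; apply: ler_sum => t ut.
  by apply: ler_wpM2r; [exact: x0|exact: dual_feasible].
under eq_bigr => u _.
  under eq_bigr do rewrite mulrDl.
  rewrite big_split /=; over.
rewrite big_split /=; apply: lerD.
  apply: ler_sum => u _; apply: le_trans (ler_wpM2l (alpha0 u) (capacity u)).
  by rewrite mulr_sumr ler_sum // => t _; rewrite mulrCA mulrA.
rewrite (exchange_big_dep xpredT) //=; apply: ler_sum => t _.
by rewrite -mulr_sumr ler_piMr.
Qed.

Lemma OFF_I_le_dual k (alpha : supply I -> R) (beta : 'I_(horizon I) -> R) :
    0 <= k -> (forall u, 0 <= alpha u) -> (forall t, 0 <= beta t) ->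
    (forall u t, (u, t) \in edges I -> mu I <= mu I * alpha u + beta t) ->
  OFF_I I k <= k * \sum_u alpha u + \sum_t beta t.
Proof.
move=> k0 alpha0 beta0 dual_feasible.
apply: ge_sup; first exact: off_objectives_neq0.
by move=> _ [x xk <-]; exact: off_weak_duality.
Qed.

Lemma off_objective_le k x : off_feasible k x -> off_objective x <= OFF_I I k.
Proof.
move=> xk; apply: ub_le_sup; last by exists x.
(* The dual point [alpha = 0], [beta = mu I] shows that the objectives are bounded, so the supremum
   is a genuine one. *)
exists (k * \sum_(u : supply I) 0 + \sum_(t < horizon I) mu I) => _ [y yk <-].
apply: off_weak_duality yk => // *; first exact/ltW/mu_gt0.
by rewrite mulr0 add0r.
Qed.

Lemma OFF_I_ge0 k : 0 <= k -> 0 <= OFF_I I k.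
Proof.
move=> k0; apply: le_trans (off_objective_le (off_feasible0 k0)).
by rewrite /off_objective big1 // => e _; rewrite mulr0.
Qed.

(** Dividing a solution by [k] brings its capacities down to 1, and [k >= 1] preserves the demand
    constraints. *)
Lemma OFF_I_le_scale k : 1 <= k -> OFF_I I k <= k * OFF_I I 1.
Proof.
move=> k1; have k0 : 0 < k by exact: lt_le_trans k1.
apply: ge_sup; first exact/off_objectives_neq0/ltW.
move=> _ [x [capacity demand x0] <-].
rewrite mulrC -ler_pdivrMr // mulrC mulr_sumr.
under eq_bigr do rewrite mulrCA.
apply: (@off_objective_le _ (fun u t => k^-1 * x u t)).
split=> [u|t|u t ut].
- under eq_bigr do rewrite mulrCA.
  by rewrite -mulr_sumr ler_pdivrMl // mulr1.
- by rewrite -mulr_sumr ler_pdivrMl // mulr1 (le_trans (demand t)).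
- by rewrite mulr_ge0 ?x0 // invr_ge0 ltW.
Qed.

(* If the optimum vanished, every factor would be an undersupply factor. *)
Lemma OFF_I1_gt0 : rational_extrema I -> 0 < OFF_I I 1.
Proof.
move=> [[q [[q1 _] qmax]] _]; rewrite lt_neqAle OFF_I_ge0 // andbT.
apply/eqP => OFF0.
have q2 : 1 <= ratr q + 1 :> R by lra.
suff : ratr q + 1 <= ratr q :> R by lra.
apply: qmax; split=> //; apply/eqP; rewrite eq_le OFF_I_le_scale //=.
by rewrite -OFF0 mulr0 OFF_I_ge0 //; lra.
Qed.

End LinearProgram.

(** * Expected consumption for a fixed sequence of decisions *)

Section ExpectedConsumption.
Variables (R : realType) (S : finType).
Implicit Types (d : seq (option S)) (c : seq bool) (u : S).

(** Removes the order of periods from the fold, so that survival of [u] becomes a conjunction of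
    independent per-period events. *)
Lemma mem_consumed d c u :
  (u \in consumed d c) = has (fun p => (p.1 == Some u) && p.2) (zip d c).
Proof.
rewrite /consumed; set s := zip d c.
suff mem_foldl C :
    (u \in foldl (@consume S) C s) =
    (u \in C) || has (fun p => (p.1 == Some u) && p.2) s.
  by rewrite mem_foldl inE.
elim: s C => [|[w b] s IHs] C /=; first by rewrite orbF.
rewrite IHs orbA; congr (_ || _).
case: w => [v|] /=; last by rewrite orbF.
rewrite /consume /=; case: b => /=; last by rewrite andbF orbF.
rewrite andbT (inj_eq Some_inj) eq_sym.
by case: ifPn => [_|/negPn vC]; rewrite ?inE; case: eqP => [->|_];
   rewrite ?vC ?orbT ?orbF.
Qed.

(** Independence in finite form: distributivity factors the expectation of a product over
    periods. *)
Lemma sum_tuple_prod n (T : finType) (F : 'I_n -> T -> R) :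
  \sum_(c : n.-tuple T) \prod_i F i (tnth c i) = \prod_i \sum_b F i b.
Proof.
rewrite bigA_distr_bigA /=.
rewrite (reindex (fun f : {ffun 'I_n -> T} => [tuple f i | i < n])) /=.
  by apply: eq_bigr => f _; apply: eq_bigr => i _; rewrite tnth_mktuple.
exists (fun c : n.-tuple T => [ffun i => tnth c i]) => [f _|c _].
  by apply/ffunP => i; rewrite ffunE tnth_mktuple.
by apply: eq_from_tnth => i; rewrite tnth_mktuple ffunE.
Qed.

Definition bernoulli_weight (m : R) (b : bool) : R := if b then m else 1 - m.

Lemma sum_bernoulli_weight (m : R) n :
  \sum_(c : n.-tuple bool) \prod_(b <- c) bernoulli_weight m b = 1.
Proof.
under eq_bigr do rewrite big_tuple.
rewrite (sum_tuple_prod (fun _ => bernoulli_weight m)) big1 // => i _.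
by rewrite big_bool /= addrC subrK.
Qed.

Lemma prob_not_consumed (m : R) n (d : n.-tuple (option S)) u :
  \sum_(c : n.-tuple bool)
    (\prod_(b <- c) bernoulli_weight m b) * (u \notin consumed d c)%:R =
  (1 - m) ^+ count_mem (Some u) d.
Proof.
(* Bernoulli weight of choice [b] in period [i], set to zero if that choice would consume [u]. Its
   sum over [b] is [1 - m] in periods matched to [u] and 1 in the others. *)
pose F i b : R :=
  bernoulli_weight m b * (~~ ((tnth d i == Some u) && b))%:R.
transitivity (\sum_(c : n.-tuple bool) \prod_i F i (tnth c i)).
  apply: eq_bigr => c _; rewrite big_split big_tuple /=; congr (_ * _).
  rewrite mem_consumed -all_predC.
  have -> (s : seq (option S * bool)) (a : pred (option S * bool)) :
      (all a s)%:R = \prod_(p <- s) (a p)%:R :> R.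
    elim: s => [|p s IHs]; first by rewrite big_nil.
    by rewrite big_cons -IHs /=; case: (a p); rewrite ?mul1r ?mul0r.
  rewrite -[zip d c]/(tval (zip_tuple d c)) big_tuple.
  apply: eq_bigr => i _.
  rewrite (tnth_nth (None, false)) nth_zip ?size_tuple //=.
  by rewrite (tnth_nth None) (tnth_nth false).
rewrite sum_tuple_prod -sum1_count big_tuple -prodrXr /= [RHS]big_mkcond /=.
apply: eq_bigr => i _; rewrite big_bool /F /= andbF andbT mulr1.
by case: (tnth d i == Some u); rewrite /= ?mulr0 ?mulr1 ?add0r // addrC subrK.
Qed.

Definition coverage (m : R) d : R :=
  \sum_u (1 - (1 - m) ^+ count_mem (Some u) d).

Lemma expected_consumption (m : R) n (d : n.-tuple (option S)) :
  \sum_(c : n.-tuple bool)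
    (\prod_(b <- c) bernoulli_weight m b) * #|consumed d c|%:R =
  coverage m d.
Proof.
under eq_bigr do rewrite -sum1_card natr_sum mulr_sumr big_mkcond /=.
rewrite exchange_big /=; apply: eq_bigr => u _.
rewrite -(prob_not_consumed m d u)
  -[X in X - _](sum_bernoulli_weight m n) -sumrB.
apply: eq_bigr => c _.
by case: (u \in _); rewrite /= ?mulr0 ?mulr1 ?subr0 ?subrr.
Qed.

(** Only the term of [v] changes, by [(1 - m) ^+ n - (1 - m) ^+ n.+1] with [n] its current load. *)
Lemma coverage_rcons (m : R) d v :
  coverage m (rcons d (Some v)) =
  coverage m d + m * (1 - m) ^+ count_mem (Some v) d.
Proof.
rewrite /coverage [in LHS](bigD1 v) //= [in RHS](bigD1 v) //=.
rewrite -[rcons _ _]cats1 count_cat /= eqxx addn0 addn1 exprS.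
rewrite [X in _ + X = _](eq_bigr
    (fun u => 1 - (1 - m) ^+ count_mem (Some u) d)); first by ring.
move=> u uv; rewrite count_cat /= (inj_eq Some_inj) eq_sym (negbTE uv).
by rewrite !addn0.
Qed.

End ExpectedConsumption.

(** * The greedy algorithm and its dual prices *)

Definition least_matched (S : finType) (N : {set S}) (prev : seq (option S)) :
    option S :=
  if [pick u in N] is Some u0 then
    Some [arg min_(u < u0 | u \in N) count_mem (Some u) prev]
  else None.

Lemma least_matched_mem (S : finType) (N : {set S}) prev u :
  least_matched N prev = Some u -> u \in N.
Proof.
rewrite /least_matched; case: pickP => // u0 u0N [<-].
by case: arg_minnP.
Qed.

Lemma least_matched_min (S : finType) (N : {set S}) prev u : u \in N ->
  exists2 v, least_matched N prev = Some v &
    (count_mem (Some v) prev <= count_mem (Some u) prev)%N.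
Proof.
move=> uN; rewrite /least_matched; case: pickP => [u0 u0N|/(_ u)]; last first.
  by rewrite uN.
by eexists => //; case: arg_minnP => // v _; apply.
Qed.

(** The rule is deterministic, so the seed space is one point with its Dirac measure. The definition
    is transparent because later proofs compute through [decide]. *)
Definition greedy (R : realType) : delayed_algorithm R.
Proof.
refine (@DelayedAlgorithm R _ unit (@dirac _ unit tt R)
  (fun S _ _ N prev => least_matched N prev) _ _) => //.
by move=> S _ _ N prev u; exact: least_matched_mem.
Defined.

Section Greedy.
Variables (R : realType) (I : instance R) (sigma : {perm 'I_(horizon I)}).
Let T := horizon I.
Let m := mu I.

Definition greedy_decisions (n : nat) : seq (option (supply I)) :=
  decisions (tt : seed (greedy R)) (arrivals sigma) n.

Local Notation load u n := (count_mem (Some u) (greedy_decisions n)).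

Definition greedy_value : R := coverage m (greedy_decisions T).

Definition marginal_gain (n : nat) : R :=
  coverage m (greedy_decisions n.+1) - coverage m (greedy_decisions n).

Lemma size_greedy_decisions n : size (greedy_decisions n) = n.
Proof. by elim: n => //= n IHn; rewrite size_rcons IHn. Qed.

Lemma greedy_decisionsS (t : 'I_T) :
  greedy_decisions t.+1 =
  rcons (greedy_decisions t)
    (least_matched (neighbors (sigma t)) (greedy_decisions t)).
Proof.
rewrite /greedy_decisions /=; congr rcons; congr least_matched.
by rewrite (nth_map t) ?size_enum_ord // nth_ord_enum.
Qed.

Lemma load_mono u n n' : (n <= n')%N -> (load u n <= load u n')%N.
Proof.
move=> /subnK <-; elim: (n' - n)%N => //= k IHk.
rewrite (leq_trans IHk) // addSn /greedy_decisions /=.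
by rewrite -cats1 count_cat leq_addr.
Qed.

(** The node chosen at [t] has load at most that of [u], which only grows until [T], and powers of
    [1 - m] do not increase with the exponent. This is the dual constraint of the edge when [u] is
    priced at its final consumption probability. *)
Lemma marginal_gain_ge u (t : 'I_T) : (u, sigma t) \in edges I ->
  m * (1 - m) ^+ load u T <= marginal_gain t.
Proof.
move=> ut; have [|v vE vle] :=
    @least_matched_min _ (neighbors (sigma t)) (greedy_decisions t) u.
  by rewrite inE.
rewrite /marginal_gain greedy_decisionsS vE coverage_rcons addrAC subrr add0r.
have := mu_gt0 I; have := mu_le1 I; rewrite -/m => m1 m0.
rewrite ler_pM2l //; apply: ler_wiXn2l; [lra|lra|].
exact/(leq_trans vle)/load_mono/ltnW.
Qed.

Lemma marginal_gain_ge0 (t : 'I_T) : 0 <= marginal_gain t.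
Proof.
have [u ut] := has_neighbor (sigma t).
apply: le_trans (marginal_gain_ge ut).
have := mu_gt0 I; have := mu_le1 I; rewrite -/m => m1 m0.
by rewrite mulr_ge0 ?exprn_ge0 //; lra.
Qed.

Lemma sum_marginal_gain : \sum_(t < T) marginal_gain t = greedy_value.
Proof.
rewrite -(big_mkord xpredT marginal_gain) telescope_sumr //.
by rewrite {2}/coverage big1 ?subr0 // => u _; rewrite expr0 subrr.
Qed.

Lemma OFF_I_le_greedy k : 0 <= k -> OFF_I I k <= (1 + k) * greedy_value.
Proof.
move=> k0; have := mu_gt0 I; have := mu_le1 I; rewrite -/m => m1 m0.
(* Gains are indexed by periods but dual prices by demand nodes; the inverse of [sigma] sends a node
   to its arrival period. *)
have -> : (1 + k) * greedy_value =
    k * \sum_u (1 - (1 - m) ^+ load u T) +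
    \sum_t marginal_gain ((sigma^-1)%g t).
  rewrite (reindex_perm sigma) /=.
  under [X in _ = _ + X]eq_bigr do rewrite permK.
  by rewrite sum_marginal_gain /greedy_value /coverage mulrDl mul1r addrC.
apply: OFF_I_le_dual => // [u|t|u t ut].
- by rewrite subr_ge0 exprn_ile1 //; lra.
- exact: marginal_gain_ge0.
have := @marginal_gain_ge u ((sigma^-1)%g t); rewrite permKV => /(_ ut).
by rewrite -/m; lra.
Qed.

Lemma expected_value_greedy :
  expected_value (greedy R) sigma = greedy_value%:E.
Proof.
rewrite /expected_value -(expectation_cst (seed_law (greedy R))).
congr expectation; apply/funext => -[].
have sz : size (greedy_decisions T) == T by rewrite size_greedy_decisions.
exact: (expected_consumption m (Tuple sz)).
Qed.

End Greedy.

(** * From the LP bound to competitive ratios *)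

Lemma greedy_competitive (R : realType) (F : instance R -> Prop) (k c : R) :
    0 <= k ->
    (forall I, F I ->
      rational_extrema I /\ c * (1 + k) * OFF_I I 1 <= OFF_I I k) ->
  (c%:E <= competitive_ratio (greedy R) F)%E.
Proof.
move=> k0 Fk; apply: le_ereal_inf_tmp => _ [I /Fk[/OFF_I1_gt0 OFF0 Ik] ->].
apply: le_ereal_inf_tmp => _ [sigma _ <-].
rewrite expected_value_greedy inver gt_eqF // lee_pdivlMr // lee_fin.
have := le_trans Ik (OFF_I_le_greedy sigma k0).
by rewrite -mulrA mulrCA ler_pM2l //; lra.
Qed.

Theorem theorem1 (R : realType) (kappa : R) (kappa_gt0 : 0 < kappa) :
  exists A : delayed_algorithm R,
    ((Num.max (1 / (1 + kappa)) (kappa / (1 + kappa)))%:E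
       <= competitive_ratio A (undersupplied kappa))%E /\
    ((Num.max (1 / (1 + kappa)) (kappa / (1 + kappa)))%:E
       <= competitive_ratio A (oversupplied kappa))%E.
Proof.
have k1 : 0 < 1 + kappa by lra.
exists (greedy R).
split; apply: (@greedy_competitive _ _ kappa) (ltW _) _ => //.
- move=> I [ext [[kappa1 ->] _]]; split=> //.
  (* Here [kappa >= 1], so the maximum is [kappa / (1 + kappa)], and its product with [1 + kappa] is
     exactly the scaling factor [kappa]. *)
  rewrite max_r ?divfK ?gt_eqF //.
  by rewrite ler_pM2r ?invr_gt0.
- move=> I [ext [[/andP[_ kappa1] ->] _]]; split=> //.
  (* Here [kappa <= 1], so the maximum is [1 / (1 + kappa)], and its product with [1 + kappa] is
     1. *)
  rewrite max_l ?divfK ?gt_eqF ?mul1r //.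
  by rewrite -[leRHS]mul1r ler_pM2r ?invr_gt0.
Qed.
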